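(* Let $n\ge 1$, $T\in\mathrm{Str}(n)$ and $1\le k\le n$. Then $\mathcal W_{n,0}(T)^{k-1}$ divides all $k\times k$ minors of $\mathcal W_{n,1}(T)$ (viewed as an $n\times n$ matrix in the canonical basis of $W_{n,1}$) in the ring $\mathbb Z[t^{1/2},t^{-1/2}]$.
   Context: Tangles and string links. Tangles are oriented tangles in $\mathbb R\times[0,1]$ (presented by diagrams, up to isotopy and Reidemeister moves). A tangle $T:\iota^n\to\iota^n$ has bottom endpoints $(1,0),\dots,(n,0)$ and top endpoints $(1,1),\dots,(n,1)$, with the strands oriented upwards at all endpoints; it may have closed components. A string link on $n$ strands is a tangle $\iota^n\to\iota^n$ consisting of precisely $n$ interval components (and no closed components), each having one endpoint at the bottom and the other at the top (the permutation of endpoints is arbitrary). String links form a monoid $\mathrm{Str}(n)$ under stacking, containing the braid group $B_n$. The generator $\sigma_i\in B_n$ is the positive crossing (both strands upwards) in which the overcrossing strand goes from bottom position $i$ to top position $i+1$ and the undercrossing strand from bottom position $i+1$ to top position $i$. The (partial) closure of a braid $b\in B_{n+m}$ is the tangle $\iota^n\to\iota^n$ obtained by connecting, for $j=n+1,\dots,n+m$, the top endpoint of $b$ at position $j$ to its bottom endpoint at position $j$ by disjoint arcs passing to the right of $b$. Every tangle $\iota^n\to\iota^n$ is such a closure. Ohtsuki's tangle functor $\mathcal V$. Let $V$ be the free $\mathbb Z[t^{1/2},t^{-1/2}]$-module with basis $e_0,e_1$. Let $R\in\mathrm{End}(V\otimes V)$ be given by $R(e_0\otimes e_0)=t^{-1/2}e_0\otimes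 e_0$, $R(e_0\otimes e_1)=e_1\otimes e_0$, $R(e_1\otimes e_0)=e_0\otimes e_1+(t^{-1/2}-t^{1/2})e_1\otimes e_0$, $R(e_1\otimes e_1)=-t^{1/2}e_1\otimes e_1$. For braids, $\mathcal V:B_n\to\mathrm{End}(V^{\otimes n})$ is the homomorphism $\sigma_i\mapsto \mathrm{id}^{\otimes i-1}\otimes R\otimes\mathrm{id}^{\otimes n-i-1}$. Let $h=t^{1/2}\,\mathrm{diag}(1,-1)$ on $V$ and $\mathrm{Tr}_m(g)=\mathrm{trace}_{V^{\otimes m}}(h^{\otimes m}g)$ for $g\in\mathrm{End}(V^{\otimes m})$. If $T:\iota^n\to\iota^n$ is the closure of $b\in B_{n+m}$, then $\mathcal V(T)=(\mathrm{id}\otimes\mathrm{Tr}_m)(\mathcal V(b))\in\mathrm{End}(V^{\otimes n})$, using $\mathrm{End}(V^{\otimes(n+m)})\cong\mathrm{End}(V^{\otimes n})\otimes\mathrm{End}(V^{\otimes m})$. This is independent of the choice of $b$ (it is the value on $T$ of Ohtsuki's functor associated to the Alexander polynomial). Graded parts. $W_{n,k}\subset V^{\otimes n}$ is the span of the $e_{i_1}\otimes\dots\otimes e_{i_n}$ with exactly $k$ of the indices $i_s$ equal to $1$ (these vectors form its canonical basis). $\mathcal V(T)$ preserves each $W_{n,k}$, and $\mathcal W_{n,k}(T)=\mathcal V(T)|_{W_{n,k}}$. Since $W_{n,0}$ has rank one, $\mathcal W_{n,0}(T)$ is regarded as an element of $\mathbb Z[t^{1/2},t^{-1/2}]$. 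*)

(* Defs.v *)
(* boolp is used only to turn the membership predicate of the ring Z[s, s^-1]
   into a boolean one. *)
From HB Require Import structures.
From Stdlib Require Export Relation_Operators.
From mathcomp Require Export all_boot all_order all_fingroup all_algebra.
From mathcomp Require Import boolp.

Set Implicit Arguments.
Unset Strict Implicit.
Unset Printing Implicit Defensive.

Import GRing.Theory.

(** * Oriented tangle diagrams *)

(* Diagrams are in general position with respect to the height function: they
   are cut into slices, listed from bottom to top, each containing exactly one
   minimum, maximum or crossing.  [(i, a)] is the slice containing [a], with
   [i] vertical strands to its left.
   - [Cup o] is a minimum; its left leg is oriented upwards iff [o];
   - [Cap] is a maximum;
   - [Cross s] is a crossing; the strand running from bottom left to top right
     is the overcrossing one iff [s].
   A horizontal section is recorded as a sequence of orientations, from left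
   to right, [true] meaning upwards. *)
Inductive event := Cup of bool | Cap | Cross of bool.

Definition slice : Type := nat * event.

Definition n_in (a : event) : nat := if a is Cup _ then 0 else 2.
Definition n_out (a : event) : nat := if a is Cap then 0 else 2.

Definition run_slice (c : slice) (w : seq bool) : option (seq bool) :=
  let: (i, a) := c in
  match a with
  | Cup o =>
      if i <= size w then Some (take i w ++ [:: o; ~~ o] ++ drop i w) else None
  | Cap =>
      if drop i w is x :: y :: w' then
        if x != y then Some (take i w ++ w') else None
      else None
  | Cross _ =>
      if drop i w is x :: y :: w' then Some (take i w ++ [:: y, x & w'])
      else None
  end.

(* Top section of a diagram with bottom section [w]; [None] if the slices do
   not fit together. *)
Fixpoint run (D : seq slice) (w : seq bool) : option (seq bool) :=
  if D is c :: D' then obind (run D') (run_slice c w) else Some w.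

Record tangle (v w : seq bool) := Tangle {
  slices :> seq slice;
  _ : run slices v == Some w
}.

Definition ups (n : nat) : seq bool := nseq n true.

(** ** Isotopy *)

(* Planar isotopies (interchange of heights of distant events, cancellation of
   a minimum with a maximum, sliding a strand past an extremum) and the three
   Reidemeister moves.  The condition in [move_R3] excludes the configurations
   in which the three strands lie cyclically above one another. *)
Inductive local_move : seq slice -> seq slice -> Prop :=
| move_far i d a b :
    local_move [:: (i, a); (i + n_out a + d, b)]
               [:: (i + n_in a + d, b); (i, a)]
| move_zigzag_l i o : local_move [:: (i.+1, Cup o); (i, Cap)] [::]
| move_zigzag_r i o : local_move [:: (i, Cup o); (i.+1, Cap)] [::]
| move_slide_cup i o s :
    local_move [:: (i, Cup o); (i.+1, Cross s)]
               [:: (i.+1, Cup o); (i, Cross (~~ s))]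
| move_slide_cap i s :
    local_move [:: (i.+1, Cross s); (i, Cap)]
               [:: (i, Cross (~~ s)); (i.+1, Cap)]
| move_R1_cup i o s :
    local_move [:: (i, Cup o); (i, Cross s)] [:: (i, Cup (~~ o))]
| move_R1_cap i s : local_move [:: (i, Cross s); (i, Cap)] [:: (i, Cap)]
| move_R2 i s : local_move [:: (i, Cross s); (i, Cross (~~ s))] [::]
| move_R3 i a b c of (a == b) || (b == c) :
    local_move [:: (i, Cross a); (i.+1, Cross b); (i, Cross c)]
               [:: (i.+1, Cross c); (i, Cross b); (i.+1, Cross a)].

Definition elementary_isotopy (v w : seq bool) (S T : tangle v w) : Prop :=
  exists A B L L' : seq slice,
    [/\ local_move L L', slices S = A ++ L ++ B & slices T = A ++ L' ++ B].

Definition isotopic (v w : seq bool) : tangle v w -> tangle v w -> Prop :=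
  clos_refl_sym_trans _ (@elementary_isotopy v w).

(** ** Components and string links *)

(* [(l, p)] is the point in which the strand at position [p] (from the left)
   crosses the section lying above the first [l] slices. *)
Definition point : Type := nat * nat.

Definition is_point (v w : seq bool) (T : tangle v w) (x : point) : Prop :=
  x.1 <= size T /\ exists2 u, run (take x.1 T) v = Some u & x.2 < size u.

(* Two points are joined by a single arc inside one slice. *)
Inductive joined (D : seq slice) : point -> point -> Prop :=
| arc_left l i a p of onth D l = Some (i, a) & p < i :
    joined D (l, p) (l.+1, p)
| arc_right l i a d of onth D l = Some (i, a) :
    joined D (l, i + n_in a + d) (l.+1, i + n_out a + d)
| arc_cup l i o of onth D l = Some (i, Cup o) :
    joined D (l.+1, i) (l.+1, i.+1)
| arc_cap l i of onth D l = Some (i, Cap) :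
    joined D (l, i) (l, i.+1)
| arc_cross_lr l i s of onth D l = Some (i, Cross s) :
    joined D (l, i) (l.+1, i.+1)
| arc_cross_rl l i s of onth D l = Some (i, Cross s) :
    joined D (l, i.+1) (l.+1, i).

Definition same_component (D : seq slice) : point -> point -> Prop :=
  clos_refl_sym_trans _ (joined D).

Definition bottom_point (p : nat) : point := (0, p).
Definition top_point (D : seq slice) (p : nat) : point := (size D, p).

(* Every component meets some section, and it is an interval iff it contains an
   endpoint of the tangle. *)
Definition no_closed_component (v w : seq bool) (T : tangle v w) : Prop :=
  forall x, is_point T x ->
    (exists2 p, p < size v & same_component T x (bottom_point p)) \/
    (exists2 p, p < size w & same_component T x (top_point T p)).

Definition string_link (n : nat) (T : tangle (ups n) (ups n)) : Prop :=
  no_closed_component T /\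
  exists s : 'S_n, forall i j : 'I_n,
    same_component T (bottom_point i) (top_point T j) <-> j = s i.

(** ** Braids and their partial closures *)

(* [(i, true)] is the generator sigma_(i+1) of the braid group on [N] strands
   and [(i, false)] its inverse; letters are listed from bottom to top. *)
Definition braid (N : nat) : Type := seq ('I_N.-1 * bool).

Definition braid_slices (N : nat) (b : braid N) : seq slice :=
  [seq (nat_of_ord c.1, Cross c.2) | c <- b].

Definition closure_slices (n m : nat) (b : braid (n + m)) : seq slice :=
  [seq (n + j, Cup true) | j <- iota 0 m] ++ braid_slices b ++
  [seq (n + j, Cap) | j <- rev (iota 0 m)].

Lemma run_cat D E w : run (D ++ E) w = obind (run E) (run D w).
Proof. by elim: D w => [|c D IH] w //=; case: (run_slice c w). Qed.

Lemma iotaSr m : iota 0 m.+1 = rcons (iota 0 m) m.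
Proof. by rewrite -cats1 -addn1 iotaD. Qed.

Lemma ups_rcons n m : ups (n + m.+1) = ups (n + m) ++ [:: true].
Proof. by rewrite addnS -addn1 /ups nseqD. Qed.

Lemma run_cups n m :
  run [seq (n + j, Cup true) | j <- iota 0 m] (ups n)
  = Some (ups (n + m) ++ nseq m false).
Proof.
elim: m => [|m IH]; first by rewrite addn0 cats0.
rewrite iotaSr map_rcons -cats1 run_cat {}IH /=.
have sz : size (ups (n + m)) = n + m by rewrite size_nseq.
rewrite take_cat drop_cat sz ltnn subnn take0 drop0 cats0 size_cat sz leq_addr.
by rewrite ups_rcons -catA.
Qed.

Lemma run_caps n m :
  run [seq (n + j, Cap) | j <- rev (iota 0 m)] (ups (n + m) ++ nseq m false)
  = Some (ups n).
Proof.
elim: m => [|m IH]; first by rewrite addn0 cats0.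
rewrite iotaSr rev_rcons.
have sz : size (ups (n + m)) = n + m by rewrite size_nseq.
rewrite ups_rcons -catA /=.
by rewrite take_cat drop_cat sz ltnn subnn take0 drop0 cats0 /= IH.
Qed.

Lemma run_braid N (b : braid N) w :
  run (braid_slices b) (ups N ++ w) = Some (ups N ++ w).
Proof.
elim: b => [|[i s] b IH] //=.
have lt_iN : i.+1 < N by rewrite -ltn_predRL.
have upsE : ups N = ups i ++ [:: true, true & ups (N - i.+2)].
  by rewrite -[in LHS](subnKC lt_iN) -addn2 -addnA /ups nseqD.
have szi : size (ups i) = i by rewrite size_nseq.
have drE : drop i (ups N ++ w) = [:: true, true & ups (N - i.+2) ++ w].
  by rewrite upsE -catA drop_cat szi ltnn subnn drop0.
have tkE : take i (ups N ++ w) = ups i.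
  by rewrite upsE -catA take_cat szi ltnn subnn take0 cats0.
rewrite drE tkE /= -[RHS]IH; congr (run _ _).
by rewrite upsE -catA.
Qed.

Lemma run_closure n m (b : braid (n + m)) :
  run (closure_slices b) (ups n) == Some (ups n).
Proof. by rewrite !run_cat run_cups /= run_cat run_braid /= run_caps. Qed.

Definition braid_closure (n m : nat) (b : braid (n + m)) :
    tangle (ups n) (ups n) :=
  Tangle (run_closure b).

(** * The ring of Laurent polynomials in t^(1/2) *)

Local Open Scope ring_scope.

Local Notation "x %:F" := (@FracField.tofrac _ x).

(* Z[s, s^-1] is the subring of the field of fractions of Z[s] consisting of
   the fractions whose denominator is a power of s = t^(1/2). *)
Definition is_laurent : {pred {fraction {poly int}}} :=
  fun x => `[< exists (p : {poly int}) (i : nat), x = p%:F / ('X^i)%:F >].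

Lemma Xn_tofrac_neq0 i : ('X^i : {poly int})%:F != 0.
Proof. by rewrite tofrac_eq0 monic_neq0 // monicXn. Qed.

Lemma is_laurent_subring : subring_closed is_laurent.
Proof.
split=> [|x y /asboolP[p [i ->]] /asboolP[q [j ->]]
         |x y /asboolP[p [i ->]] /asboolP[q [j ->]]]; apply/asboolP.
- by exists 1, 0%N; rewrite expr0 tofrac1 divr1.
- exists (p * 'X^j - q * 'X^i), (i + j)%N.
  by rewrite -mulNr addf_div ?Xn_tofrac_neq0 // exprD
             !(tofracD, tofracN, tofracM) mulNr.
- by exists (p * q), (i + j)%N; rewrite mulf_div exprD !tofracM.
Qed.

HB.instance Definition _ :=
  GRing.isSubringClosed.Build _ is_laurent is_laurent_subring.

Record laurent := Laurent {
  laurent_val : {fraction {poly int}};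
  laurent_valP : laurent_val \in is_laurent
}.

HB.instance Definition _ := [isSub for laurent_val].
HB.instance Definition _ := [Choice of laurent by <:].
HB.instance Definition _ := [SubChoice_isSubComNzRing of laurent by <:].

Lemma sqrt_t_proof : ('X : {poly int})%:F \in is_laurent.
Proof. by apply/asboolP; exists 'X, 0%N; rewrite expr0 tofrac1 divr1. Qed.

Lemma sqrt_tV_proof : (('X : {poly int})%:F)^-1 \in is_laurent.
Proof. by apply/asboolP; exists 1, 1%N; rewrite expr1 tofrac1 div1r. Qed.

Definition sqrt_t : laurent := Laurent sqrt_t_proof.
Definition sqrt_tV : laurent := Laurent sqrt_tV_proof.

Lemma sqrt_tK : sqrt_t * sqrt_tV = 1.
Proof. by apply: val_inj; rewrite /= mulfV // (Xn_tofrac_neq0 1). Qed.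

(** * The functor on braids and closures *)

(* The basis of the n-th tensor power of V: [x] stands for the tensor product
   of the e_(x i), where [false] is the index 0 and [true] the index 1. *)
Notation tbasis n := {ffun 'I_n -> bool}.

Definition tend (n : nat) : Type := 'M[laurent]_#|{: tbasis n}|.

(* [mkend f] maps e_y to the sum of the [f x y] e_x; [coef g x y] is the
   coefficient of e_x in the image of e_y under [g]. *)
Definition mkend (n : nat) (f : tbasis n -> tbasis n -> laurent) : tend n :=
  \matrix_(i, j) f (enum_val i) (enum_val j).
Definition coef (n : nat) (g : tend n) (x y : tbasis n) : laurent :=
  (g : 'M_#|{: tbasis n}|) (enum_rank x) (enum_rank y).

(* [Rmat x y] is the coefficient of e_x in the image of e_y under R, for pairs
   [x], [y] of indices; [RmatV] is the inverse of R. *)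
Definition Rmat (x y : bool * bool) : laurent :=
  match y, x with
  | (false, false), (false, false) => sqrt_tV
  | (false, true), (true, false) => 1
  | (true, false), (false, true) => 1
  | (true, false), (true, false) => sqrt_tV - sqrt_t
  | (true, true), (true, true) => - sqrt_t
  | _, _ => 0
  end.

Definition RmatV (x y : bool * bool) : laurent :=
  match y, x with
  | (false, false), (false, false) => sqrt_t
  | (false, true), (false, true) => sqrt_t - sqrt_tV
  | (false, true), (true, false) => 1
  | (true, false), (false, true) => 1
  | (true, true), (true, true) => - sqrt_tV
  | _, _ => 0
  end.

Lemma RmatK x y : \sum_z Rmat x z * RmatV z y = (x == y)%:R.
Proof.
have -> (F : bool * bool -> laurent) : \sum_z F z =
    F (true, true) + F (true, false) + (F (false, true) + F (false, false)).
  rewrite (eq_bigr (fun z => F (z.1, z.2))); last by case.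
  by rewrite -(pair_bigA _ (fun a b => F (a, b))) /= !big_bool.
case: x => [[] []]; case: y => [[] []] /=;
  rewrite !(mul0r, mulr0, addr0, add0r, mul1r, mulr1, mulrNN) ?sqrt_tK //.
- by rewrite -[sqrt_t - _]opprB subrr.
- by rewrite mulrC sqrt_tK.
Qed.

Definition lpos (N : nat) (i : 'I_N.-1) : 'I_N := widen_ord (leq_pred N) i.

Lemma rpos_proof (N : nat) (i : 'I_N.-1) : (i.+1 < N)%N.
Proof. by rewrite -ltn_predRL. Qed.

Definition rpos (N : nat) (i : 'I_N.-1) : 'I_N := Ordinal (rpos_proof i).

Definition V_letter (N : nat) (c : 'I_N.-1 * bool) : tend N :=
  let: (i, s) := c in
  mkend (fun x y =>
    (if s then Rmat else RmatV) (x (lpos i), x (rpos i))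
                                (y (lpos i), y (rpos i))
    * [forall j, (j != lpos i) && (j != rpos i) ==> (x j == y j)]%:R).

(* The composition of operators matches stacking: a letter placed above
   composes on the left. *)
Fixpoint V_braid (N : nat) (b : braid N) : tend N :=
  if b is c :: b' then V_braid b' *m V_letter c else 1%:M.

(* The matrix of h = t^(1/2) diag(1, -1). *)
Definition hmat (a b : bool) : laurent :=
  if a == b then (if a then - sqrt_t else sqrt_t) else 0.

Definition htens (m : nat) (x y : tbasis m) : laurent :=
  \prod_(i < m) hmat (x i) (y i).

Definition tjoin (n m : nat) (x : tbasis n) (z : tbasis m) : tbasis (n + m) :=
  [ffun i => match split i with inl j => x j | inr j => z j end].

(* (id (x) Tr_m)(g), where Tr_m(g') is the trace of h^(x m) g'. *)
Definition partial_trace (n m : nat) (g : tend (n + m)) : tend n :=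
  mkend (fun x y =>
    \sum_z \sum_u htens z u * coef g (tjoin x u) (tjoin y z)).

(* [is_V T g] : the value of the tangle functor on [T] is [g]. *)
Definition is_V (n : nat) (T : tangle (ups n) (ups n)) (g : tend n) : Prop :=
  exists (m : nat) (b : braid (n + m)),
    isotopic T (braid_closure b) /\ g = partial_trace (V_braid b).

(** * Graded parts *)

(* The diagonal blocks of [g] for the submodules spanned by the basis vectors
   having no index, resp. exactly one index, equal to 1; the i-th vector of the
   latter basis has its index 1 in position i. *)
Definition W0 (n : nat) (g : tend n) : laurent :=
  coef g [ffun=> false] [ffun=> false].

Definition W1 (n : nat) (g : tend n) : 'M[laurent]_n :=
  \matrix_(i, j) coef g [ffun l => l == i] [ffun l => l == j].

Definition strictly_increasing (k n : nat) (f : 'I_k -> 'I_n) : Prop :=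
  forall i j : 'I_k, (i < j)%N -> (f i < f j)%N.

(* Main.v *)
Require Import Defs.
From mathcomp Require Import all_boot all_order all_algebra zify ring.

(** The divisibility is an identity: if [T] is the closure of a braid, the
    minor of W_(n,1)(T) with rows i_1 < ... < i_k and columns j_1 < ... < j_k
    equals W_(n,0)(T)^(k-1) times the coefficient of V(T) from
    e_(j_1) ^ ... ^ e_(j_k) to e_(i_1) ^ ... ^ e_(i_k), where W_(n,k) is
    identified with the k-th exterior power of W_(n,1).

    Each generator acts on V (x) V, up to the scalar t^(-1/2), as the exterior
    algebra functor applied to the 2 x 2 Burau matrix acting on the span of
    e_1 (x) e_0 and e_0 (x) e_1.  Hence V(b) is a unit [vacuum b] times the
    exterior algebra of a Burau matrix rho = [burau b], i.e. all its
    coefficients are minors of rho ([V_braid_minors]).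

    Write rho = (A B; C D) with D the block of the m strands that are closed.
    Since h is diagonal with entries t^(1/2), -t^(1/2), the partial trace is,
    up to t^(m/2), the signed sum over Z of the minors of rho in which rows and
    columns Z of D have been added.  Such a sum is a single determinant
    ([det_principal_expansion]), so that the coefficients of V(T) are
          c det (A_IJ  B_I; - C_J  1 - D)
    with c independent of I and J ([partial_trace_minors]).  For I, J empty
    this is W_(n,0)(T) = c det (1 - D), and for I, J singletons these are the
    entries of W_(n,1)(T), which are thus bordered minors of 1 - D.  Sylvester's
    identity for determinants of bordered minors ([sylvester]) concludes; it
    holds even if det (1 - D) = 0. *)

Set Implicit Arguments.
Unset Strict Implicit.
Unset Printing Implicit Defensive.

Import GRing.Theory.

Local Open Scope ring_scope.

(** * Maps between index sets *)

Definition sum_case (p q : nat) (T : Type) (f : 'I_p -> T) (g : 'I_q -> T)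
    (a : 'I_(p + q)) : T :=
  match split a with inl b => f b | inr c => g c end.

Definition sum_map (p q n m : nat) (f : 'I_p -> 'I_n) (g : 'I_q -> 'I_m) :
    'I_(p + q) -> 'I_(n + m) :=
  sum_case (lshift m \o f) (@rshift n m \o g).

Definition onset (m : nat) (z : {ffun 'I_m -> bool}) : {set 'I_m} :=
  [set b | z b].

Definition onset_val (m : nat) (z : {ffun 'I_m -> bool}) :
  'I_#|onset z| -> 'I_m := @enum_val _ (mem (onset z)).
Arguments onset_val {m} z _.

Lemma sum_case_l p q T (f : 'I_p -> T) (g : 'I_q -> T) b :
  sum_case f g (lshift q b) = f b.
Proof. by rewrite /sum_case -[lshift q b]/(unsplit (inl b)) unsplitK. Qed.

Lemma sum_case_r p q T (f : 'I_p -> T) (g : 'I_q -> T) c :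
  sum_case f g (rshift p c) = g c.
Proof. by rewrite /sum_case -[rshift p c]/(unsplit (inr c)) unsplitK. Qed.

Lemma mxsub_sum_case (S : Type) p q p' q' n m (f1 : 'I_p -> 'I_n)
    (f2 : 'I_q -> 'I_n) (g1 : 'I_p' -> 'I_m) (g2 : 'I_q' -> 'I_m)
    (M : 'M[S]_(n, m)) :
  mxsub (sum_case f1 f2) (sum_case g1 g2) M
  = block_mx (mxsub f1 g1 M) (mxsub f1 g2 M) (mxsub f2 g1 M) (mxsub f2 g2 M).
Proof.
apply/matrixP=> i j; rewrite mxE.
by case: (split_ordP i) => a ->; case: (split_ordP j) => b ->;
  rewrite ?(block_mxEul, block_mxEur, block_mxEdl, block_mxEdr) mxE
          ?(sum_case_l, sum_case_r).
Qed.

Lemma mxsub_sum_map (S : Type) p q p' q' n1 n2 m1 m2 (f1 : 'I_p -> 'I_n1)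
    (f2 : 'I_q -> 'I_n2) (g1 : 'I_p' -> 'I_m1) (g2 : 'I_q' -> 'I_m2)
    (A : 'M[S]_(n1, m1)) B C D :
  mxsub (sum_map f1 f2) (sum_map g1 g2) (block_mx A B C D)
  = block_mx (mxsub f1 g1 A) (mxsub f1 g2 B) (mxsub f2 g1 C) (mxsub f2 g2 D).
Proof.
rewrite mxsub_sum_case; congr block_mx; apply/matrixP=> i j;
  rewrite [LHS]mxE [RHS]mxE /=.
- by rewrite block_mxEul.
- by rewrite block_mxEur.
- by rewrite block_mxEdl.
- by rewrite block_mxEdr.
Qed.

(** * Determinants *)

Section Determinants.
Variable R : comNzRingType.

(** The sizes are related by a hypothesis, since reorderings of disjoint unions
    of index sets have sizes that are only provably equal. *)
Lemma det_mxsub_bij (q r : nat) (h : 'I_q -> 'I_r) (M : 'M[R]_r) :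
  q = r -> injective h -> \det (mxsub h h M) = \det M.
Proof.
move=> eq_qr; case: r / eq_qr h M => h M inj_h.
have -> : mxsub h h M = row_perm (perm inj_h) (col_perm (perm inj_h) M).
  by apply/matrixP=> i j; rewrite !mxE !permE.
rewrite row_permE col_permE !det_mulmx !det_perm odd_permV.
by rewrite mulrCA -signr_addb addbb mulr1.
Qed.

Lemma det_col_linear (k : nat) (A B C : 'M[R]_k) (p : 'I_k) (b c : R) :
  (forall i, A i p = b * B i p + c * C i p) ->
  (forall i q, q != p -> B i q = A i q) ->
  (forall i q, q != p -> C i q = A i q) ->
  \det A = b * \det B + c * \det C.
Proof.
move=> Ap Bq Cq; rewrite -(det_tr A) -(det_tr B) -(det_tr C).
apply: (determinant_multilinear (i0 := p)).
- by apply/rowP=> i; rewrite !mxE Ap.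
- by apply/matrixP=> q i; rewrite !mxE Bq // eq_sym neq_lift.
- by apply/matrixP=> q i; rewrite !mxE Cq // eq_sym neq_lift.
Qed.

(** The determinant is bilinear and alternating in columns [p] and [q]. *)
Lemma det_two_cols (k : nat) (A B : 'M[R]_k) (p q : 'I_k) (a b c d : R) :
  p != q ->
  (forall i, A i p = a * B i p + c * B i q) ->
  (forall i, A i q = b * B i p + d * B i q) ->
  (forall i j, j != p -> j != q -> A i j = B i j) ->
  \det A = (a * d - b * c) * \det B.
Proof.
move=> neq_pq Ap Aq Ao.
pose set2 (u v : 'I_k -> R) : 'M_k :=
  \matrix_(i, j) if j == p then u i else if j == q then v i else B i j.
have lin u v v' x y : \det (set2 u (fun i => x * v i + y * v' i))
    = x * \det (set2 u v) + y * \det (set2 u v').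
  apply: (det_col_linear (p := q)) => i.
  - by rewrite !mxE eqxx eq_sym (negbTE neq_pq).
  - by move=> j /negbTE jq; rewrite !mxE jq.
  - by move=> j /negbTE jq; rewrite !mxE jq.
have alt u : \det (set2 u u) = 0.
  rewrite -det_tr; apply: (determinant_alternate neq_pq) => i.
  by rewrite !mxE !eqxx eq_sym (negbTE neq_pq).
have bas : \det (set2 (B^~ p) (B^~ q)) = \det B.
  congr determinant; apply/matrixP=> i j; rewrite !mxE.
  by case: eqP => [->|_] //; case: eqP => [->|].
have swap : \det (set2 (B^~ q) (B^~ p)) = - \det B.
  have -> : set2 (B^~ q) (B^~ p) = xcol p q B.
    apply/matrixP=> i j; rewrite !mxE.
    case: tpermP => [->|->|/eqP/negbTE-> /eqP/negbTE->] //; rewrite ?eqxx //.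
    by rewrite eq_sym (negbTE neq_pq).
  by rewrite xcolE det_mulmx det_perm odd_tperm neq_pq expr1 mulrN1.
rewrite (@det_col_linear _ _ (set2 (B^~ p) (A^~ q)) (set2 (B^~ q) (A^~ q))
           p a c).
- have AqE (u : 'I_k -> R) : \det (set2 u (A^~ q))
      = b * \det (set2 u (B^~ p)) + d * \det (set2 u (B^~ q)).
    rewrite -lin; congr determinant; apply/matrixP=> i j; rewrite !mxE.
    by rewrite Aq.
  rewrite !AqE !alt bas swap mulr0 mulr0 add0r addr0 mulrN mulrN !mulrA -mulrBl.
  by rewrite [c * b]mulrC.
- by move=> i; rewrite !mxE eqxx.
- move=> i j /[dup] neq_jp /negbTE jp; rewrite !mxE jp.
  by case: eqP => [->|/eqP] // jq; rewrite Ao.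
- move=> i j /[dup] neq_jp /negbTE jp; rewrite !mxE jp.
  by case: eqP => [->|/eqP] // jq; rewrite Ao.
Qed.

(** Multilinearity in the rows of [1 - D]: choosing the row of [- D] exactly
    for the rows in [z] leaves unit rows outside of [z], which delete the
    corresponding columns. *)
Lemma det_principal_expansion (p m : nat) (A : 'M[R]_p) (B : 'M[R]_(p, m))
    (C : 'M[R]_(m, p)) (D : 'M[R]_m) :
  \det (block_mx A B (- C) (1%:M - D)) =
  \sum_(z : {ffun 'I_m -> bool}) (-1) ^+ #|onset z| *
    \det (mxsub (sum_map id (onset_val z)) (sum_map id (onset_val z))
            (block_mx A B C D)).
Proof.
(* [mix z] collects the term of the expansion in which the row of [- (C D)] is
   taken in the places where [z] holds, and the unit row in the others. *)
pose Y z (b : 'I_m) : 'rV[R]_(p + m) :=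
  if z then - row b (row_mx C D) else row b (row_mx 0 1%:M).
pose mix (z : {ffun 'I_m -> bool}) :=
  col_mx (row_mx A B) (\matrix_b Y (z b) b).
have -> : \det (block_mx A B (- C) (1%:M - D)) = \sum_z \det (mix z).
  rewrite /determinant exchange_big; apply: eq_bigr => s _ /=.
  rewrite -big_distrr /= big_split_ord /=; congr (_ * _).
  transitivity ((\prod_(a < p) row_mx A B a (s (lshift m a)))
      * \prod_(b < m) \sum_c Y c b 0 (s (rshift p b))).
    congr (_ * _); apply: eq_bigr => a _; first by rewrite block_mxEv col_mxEu.
    rewrite big_bool /= block_mxEv col_mxEd !mxE.
    by case: split => c; rewrite !mxE ?addr0 // addrC.
  rewrite bigA_distr_bigA big_distrr; apply: eq_bigr => z _ /=.
  rewrite big_split_ord; congr (_ * _); apply: eq_bigr => a _.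
    by rewrite col_mxEu.
  by rewrite col_mxEd [in RHS]mxE.
apply: eq_bigr => z _.
(* The reordering [h] puts the unit rows, those outside of [z], last. *)
pose off (c : 'I_#|~: onset z|) := rshift p (enum_val c).
pose h := sum_case (sum_map id (onset_val z)) off.
have h_inj : injective h.
  rewrite /h /sum_map => a b.
  case: (split_ordP a) => {}a ->; case: (split_ordP b) => {}b ->;
    rewrite ?(sum_case_l, sum_case_r).
  - case: (split_ordP a) => {}a ->; case: (split_ordP b) => {}b ->;
      rewrite ?(sum_case_l, sum_case_r) /= => /eqP;
      rewrite ?(eq_lshift, eq_rshift, eq_lrshift, eq_rlshift) // => /eqP.
      by move=> ->.
    by move/enum_val_inj=> ->.
  - case: (split_ordP a) => {}a ->; rewrite ?(sum_case_l, sum_case_r) /=.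
      by move/eqP; rewrite eq_lrshift.
    move/rshift_inj=> ab; have := enum_valP b.
    by rewrite -ab inE; have -> := enum_valP a.
  - case: (split_ordP b) => {}b ->; rewrite ?(sum_case_l, sum_case_r) /=.
      by move/eqP; rewrite eq_rlshift.
    move/rshift_inj=> ab; have := enum_valP a.
    by rewrite ab inE; have -> := enum_valP b.
  - by move/rshift_inj/enum_val_inj => ->.
have mix_up (a : 'I_p) j : mix z (lshift m a) j = row_mx A B a j.
  by rewrite col_mxEu.
have mix_on b j : z b -> mix z (rshift p b) j = - row_mx C D b j.
  by move=> zb; rewrite col_mxEd mxE /Y zb !mxE.
have mix_off b j : ~~ z b -> mix z (rshift p b) j = row_mx 0 1%:M b j.
  by move=> /negbTE zb; rewrite col_mxEd mxE /Y zb mxE.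
have zon b : z (onset_val z b) by have := enum_valP b; rewrite inE.
have zoff (c : 'I_#|~: onset z|) : ~~ z (enum_val c).
  by have := enum_valP c; rewrite !inE.
move: (mix z) mix_up mix_on mix_off => M mix_up mix_on mix_off.
have hE : mxsub h h M = block_mx
    (block_mx A (colsub (onset_val z) B) (- rowsub (onset_val z) C)
       (- mxsub (onset_val z) (onset_val z) D))
    (mxsub (sum_map id (onset_val z)) off M) 0 1%:M.
  rewrite mxsub_sum_case; congr block_mx.
  - rewrite mxsub_sum_case; congr block_mx; apply/matrixP=> i j;
      by rewrite !mxE /= ?(mix_up, mix_on) ?(row_mxEl, row_mxEr) ?mxE.
  - apply/matrixP=> c j; rewrite !mxE mix_off //.
    rewrite /sum_map; case: (split_ordP j) => {}j ->;
      rewrite ?(sum_case_l, sum_case_r) /=.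
      by rewrite row_mxEl mxE.
    rewrite row_mxEr mxE.
    by case: eqP (zoff c) => // ->; rewrite zon.
  - apply/matrixP=> c j; rewrite !mxE mix_off // row_mxEr mxE.
    by rewrite (inj_eq enum_val_inj).
rewrite -(det_mxsub_bij _ _ h_inj) ?hE; last first.
  by rewrite -addnA cardsC card_ord.
rewrite det_ublock det1 mulr1 mxsub_sum_map.
have -> : block_mx A (colsub (onset_val z) B) (- rowsub (onset_val z) C)
       (- mxsub (onset_val z) (onset_val z) D)
  = block_mx 1%:M 0 0 (- 1)%:M *m
      block_mx A (colsub (onset_val z) B) (rowsub (onset_val z) C)
        (mxsub (onset_val z) (onset_val z) D).
  by rewrite mulmx_block !mul0mx !mul1mx !addr0 !add0r !mul_scalar_mx !scaleN1r.
by rewrite det_mulmx det_lblock det1 det_scalar mul1r mxsub_id.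
Qed.

(** Schur complements with the adjugate in place of the inverse, so that [D] may
    be singular: multiply the block matrix by the one that clears its lower left
    corner. *)
Lemma det_schur (k m : nat) (A : 'M[R]_k) (B : 'M[R]_(k, m))
    (C : 'M[R]_(m, k)) (D : 'M[R]_m) :
  \det (\det D *: A - B *m \adj D *m C) * \det D
  = \det (block_mx A B C D) * \det D ^+ k.
Proof.
set d := \det D.
have: block_mx A B C D *m block_mx d%:M 0 (- (\adj D *m C)) 1%:M
    = block_mx (d *: A - B *m \adj D *m C) B 0 D.
  rewrite mulmx_block !mulmx0 !mulmx1 !add0r !mul_mx_scalar !mulmxN.
  by rewrite !mulmxA mul_mx_adj mul_scalar_mx subrr.
move/(congr1 determinant); rewrite det_mulmx det_lblock det_ublock det1.
by rewrite det_scalar mulr1 => ->.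
Qed.

Definition bordered (k m p : nat) (A : 'M[R]_k) (B : 'M[R]_(k, m))
    (C : 'M[R]_(m, k)) (D : 'M[R]_m) (f g : 'I_p -> 'I_k) : R :=
  \det (block_mx (mxsub f g A) (rowsub f B) (colsub g C) D).

(** By [det_schur] for 1 x 1 corners, the bordered minors are the entries of the
    Schur complement of [D], whose determinant [det_schur] computes as well; a
    factor [\det D] cancels. *)
Lemma sylvester_rreg (k m : nat) (A : 'M[R]_k) (B : 'M[R]_(k, m))
    (C : 'M[R]_(m, k)) (D : 'M[R]_m) :
  (0 < k)%N -> GRing.rreg (\det D) ->
  \det (\matrix_(i, j) bordered A B C D (fun _ : 'I_1 => i) (fun=> j))
  = \det (block_mx A B C D) * \det D ^+ k.-1.
Proof.
move=> k_gt0 reg_d.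
have -> : \matrix_(i, j) bordered A B C D (fun _ : 'I_1 => i) (fun=> j)
    = \det D *: A - B *m \adj D *m C.
  apply/matrixP=> i j; rewrite mxE; apply: reg_d.
  rewrite -[LHS]det_schur det_mx11; congr (_ * _).
  by rewrite mul_rowsub_mx -mxsub_mul !mxE.
by apply: reg_d; rewrite det_schur -mulrA -exprSr prednK.
Qed.

Lemma bordered_0 (k m : nat) (A : 'M[R]_k) (B : 'M_(k, m)) C (D : 'M_m)
    (f g : 'I_0 -> 'I_k) :
  bordered A B C D f g = \det D.
Proof.
by rewrite /bordered [colsub g C]thinmx0 det_ublock det_mx00 mul1r.
Qed.

End Determinants.

(** Sylvester's identity for an arbitrary [D]: replace [D] by [X + D] over the
    polynomial ring, where its determinant is a monic polynomial, hence regular,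
    and evaluate at [X = 0]. *)
Lemma sylvester (R : comNzRingType) (k m : nat) (A : 'M[R]_k) (B : 'M[R]_(k, m))
    (C : 'M[R]_(m, k)) (D : 'M[R]_m) :
  (0 < k)%N ->
  \det (\matrix_(i, j) bordered A B C D (fun _ : 'I_1 => i) (fun=> j))
  = \det (block_mx A B C D) * \det D ^+ k.-1.
Proof.
move=> k_gt0; pose ev : {rmorphism {poly R} -> R} := horner_eval (0 : R).
have evC q r (M : 'M[R]_(q, r)) : map_mx ev (map_mx polyC M) = M.
  by apply/matrixP=> i j; rewrite !mxE; apply: hornerC.
have evD : map_mx ev (char_poly_mx (- D)) = D.
  apply/matrixP=> i j; rewrite mxE; transitivity (char_poly_mx (- D) i j).[0].
    by [].
  rewrite !mxE hornerD hornerN hornerC opprK hornerMn hornerX mul0rn.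
  by rewrite add0r.
have := sylvester_rreg (map_mx polyC A) (map_mx polyC B) (map_mx polyC C)
          k_gt0 (monic_rreg (char_poly_monic (- D))).
move/(congr1 ev); rewrite rmorphM rmorphXn -!det_map_mx map_block_mx !evC evD.
move=> <-; congr determinant; apply/matrixP=> i j; rewrite !mxE -det_map_mx.
by rewrite map_block_mx !map_mxsub !evC evD.
Qed.

(** * Increasing multi-indices *)

(** The increasing multi-index [f] of length [k] names the basis vector of
    W_(N,k) that corresponds to the wedge product of its entries. *)
Definition ind (k N : nat) (f : 'I_k -> 'I_N) : tbasis N :=
  [ffun l => l \in codom f].

Lemma strictly_increasing_inj k n (f : 'I_k -> 'I_n) :
  strictly_increasing f -> injective f.
Proof.
move=> inc a b eq_f; apply/eqP; rewrite -val_eqE eqn_leq.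
by apply/andP; split; rewrite leqNgt; apply/negP=> /inc; rewrite eq_f ltnn.
Qed.

(** An increasing multi-index is the sorted enumeration of its values. *)
Lemma ind_inj k N (f g : 'I_k -> 'I_N) :
  strictly_increasing f -> strictly_increasing g -> ind f = ind g -> f =1 g.
Proof.
move=> incf incg eq_fg.
have srt (h : 'I_k -> 'I_N) : strictly_increasing h ->
    sorted (fun i j : 'I_N => i < j)%N (codom h).
  move=> inch; rewrite /codom /image_mem sorted_map.
  apply: (sub_sorted (e := fun i j : 'I_k => (i < j)%N)) => [i j /inch //|].
  by have := iota_ltn_sorted 0 k; rewrite -val_enum_ord sorted_map.
have: codom f = codom g.
  apply: (@irr_sorted_eq _ (fun i j : 'I_N => i < j)%N); rewrite ?srt //.
  - by move=> j i l; apply: ltn_trans.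
  - by move=> i; rewrite ltnn.
  - by move=> l; have /ffunP/(_ l) := eq_fg; rewrite !ffunE.
rewrite /codom /image_mem => /eq_in_map eqfg i.
by apply: eqfg; rewrite mem_enum.
Qed.

(** * Coefficients of operators *)

Lemma coef_mulmx N (A B : tend N) x y :
  coef (A *m B) x y = \sum_z coef A x z * coef B z y.
Proof.
rewrite /coef mxE (reindex enum_rank) //=.
by apply: onW_bij; exists enum_val; [apply: enum_rankK | apply: enum_valK].
Qed.

Lemma coef_mkend N F x y : coef (@mkend N F) x y = F x y.
Proof. by rewrite /coef mxE !enum_rankK. Qed.

(** * The exterior algebra action of a 2 x 2 matrix *)

(** The matrix (a b; c d) in rows and columns [l], [r], extended by the
    identity. *)
Definition local_mx (R : comNzRingType) (N : nat) (l r : 'I_N) (a b c d : R) :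
    'M[R]_N :=
  \matrix_(p, q)
    if q == l then (p == l)%:R * a + (p == r)%:R * c
    else if q == r then (p == l)%:R * b + (p == r)%:R * d
    else (p == q)%:R.

Lemma mul_local_mx (R : comNzRingType) n N (l r : 'I_N) (a b c d : R)
    (M : 'M_(n, N)) i q :
  (M *m local_mx l r a b c d) i q =
    if q == l then a * M i l + c * M i r
    else if q == r then b * M i l + d * M i r else M i q.
Proof.
have sum_delta (s : 'I_N) x : \sum_j M i j * ((j == s)%:R * x) = x * M i s.
  rewrite (bigD1 s) //= eqxx mul1r big1 ?addr0 1?mulrC // => j /negbTE->.
  by rewrite mul0r mulr0.
rewrite mxE; under eq_bigr => j _ do rewrite mxE.
case: eqP => [_|_].
  by rewrite -!sum_delta -big_split; apply: eq_bigr => j _; rewrite /= mulrDr.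
case: eqP => [_|_].
  by rewrite -!sum_delta -big_split; apply: eq_bigr => j _; rewrite /= mulrDr.
rewrite -[RHS]mul1r -sum_delta; apply: eq_bigr => j _.
by rewrite mulr1.
Qed.

(** The matrix, in the convention of [Rmat], of [u] times the exterior algebra
    of (a b; c d): the first basis vector of the plane is e_1 (x) e_0 and the
    second one is e_0 (x) e_1. *)
Definition matchgate (u a b c d : laurent) (x y : bool * bool) : laurent :=
  match y, x with
  | (false, false), (false, false) => u
  | (true, false), (true, false) => u * a
  | (true, false), (false, true) => u * c
  | (false, true), (true, false) => u * b
  | (false, true), (false, true) => u * d
  | (true, true), (true, true) => u * (a * d - b * c)
  | _, _ => 0
  end.

Definition upd (N : nat) (l r : 'I_N) (y : tbasis N) (p : bool * bool) :
    tbasis N :=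
  [ffun j => if j == l then p.1 else if j == r then p.2 else y j].

Lemma sum_local N (l r : 'I_N) (F : tbasis N -> laurent)
    (Q : bool * bool -> bool * bool -> laurent) (y : tbasis N) :
  l != r ->
  \sum_z F z * (Q (z l, z r) (y l, y r)
    * [forall j, (j != l) && (j != r) ==> (z j == y j)]%:R)
  = \sum_p F (upd l r y p) * Q p (y l, y r).
Proof.
move=> neq_lr.
rewrite (partition_big (fun z : tbasis N => (z l, z r)) xpredT) //=.
apply: eq_bigr => p _.
have updp : (upd l r y p l, upd l r y p r) = p.
  by rewrite !ffunE !eqxx eq_sym (negbTE neq_lr); case: p.
rewrite (bigD1 (upd l r y p)) /=; last exact/eqP.
rewrite updp big1 ?addr0.
  have -> : [forall j, (j != l) && (j != r) ==> (upd l r y p j == y j)].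
    apply/forallP=> j; apply/implyP=> /andP[/negbTE jl /negbTE jr].
    by rewrite ffunE jl jr.
  by rewrite mulr1.
move=> z /andP[/eqP zp neq_z].
case: forallP => [agree|_]; last by rewrite !mulr0.
case/eqP: neq_z; apply/ffunP=> j; rewrite ffunE -zp /=.
case: eqP => [-> //|/eqP jl]; case: eqP => [-> //|/eqP jr].
by apply/eqP; apply: (implyP (agree j)); rewrite jl.
Qed.

Lemma sum_bool_pair (F : bool * bool -> laurent) : \sum_p F p =
  F (true, true) + F (true, false) + (F (false, true) + F (false, false)).
Proof.
rewrite (eq_bigr (fun z => F (z.1, z.2))); last by case.
by rewrite -(pair_bigA _ (fun a b => F (a, b))) /= !big_bool.
Qed.

Lemma upd_id N (l r : 'I_N) (y : tbasis N) p :
  (y l, y r) = p -> upd l r y p = y.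
Proof.
move=> <-; apply/ffunP=> j; rewrite ffunE /=.
by case: eqP => [->|_] //; case: eqP => [->|].
Qed.

(** Exchanging two neighbouring values keeps the order unless both occur.  So a
    crossing of adjacent strands moves a lone e_1 without a reordering sign. *)
Lemma strictly_increasing_tperm k N (l r : 'I_N) (g : 'I_k -> 'I_N) :
  r = l.+1 :> nat -> ~~ ((l \in codom g) && (r \in codom g)) ->
  strictly_increasing g -> strictly_increasing (tperm l r \o g).
Proof.
move=> rl ng inc i j /inc ij /=.
have notboth : ~ (g i = l :> nat /\ g j = r :> nat).
  by case=> /val_inj gi /val_inj gj; case/negP: ng; rewrite -gi -gj !codom_f.
have tpermE x : tperm l r x =
    (if x == l :> nat then r else if x == r :> nat then l else x) :> nat.
  by rewrite permE /= !val_eqE; case: ifP => //; case: ifP.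
by rewrite !tpermE; repeat (case: ifP => /eqP ?); lia.
Qed.

Lemma ind_tperm k N (l r : 'I_N) (g : 'I_k -> 'I_N) :
  ind (tperm l r \o g) = upd l r (ind g) (ind g r, ind g l).
Proof.
apply/ffunP=> j; rewrite !ffunE /=.
have -> : (j \in codom (tperm l r \o g)) = (tperm l r j \in codom g).
  apply/codomP/codomP => -[x jx]; exists x; first by rewrite jx /= tpermK.
  by rewrite /= -jx tpermK.
by rewrite permE /=; case: eqP => // _; case: eqP.
Qed.

(** The exterior algebra functor is multiplicative for a right factor that acts
    on two neighbouring coordinates.  In the coefficients [F] of the left factor
    the column multi-index [g] is changed in at most one place, from [l] to [r]
    or back, so that the determinant on the right is expanded along the one or
    two columns of [g] with values [l] and [r]. *)
Lemma matchgate_minors k N (l r : 'I_N) (u a b c d v : laurent)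
    (F : tbasis N -> laurent) (f : 'I_k -> 'I_N) (M : 'M_N) :
  r = l.+1 :> nat ->
  (forall g, strictly_increasing g -> F (ind g) = v * \det (mxsub f g M)) ->
  forall g : 'I_k -> 'I_N, strictly_increasing g ->
  \sum_p F (upd l r (ind g) p) * matchgate u a b c d p (ind g l, ind g r)
  = v * u * \det (mxsub f g (M *m local_mx l r a b c d)).
Proof.
move=> rl FE g incg; have inj_g := strictly_increasing_inj incg.
have neq_rl : r != l by rewrite -val_eqE /= rl; lia.
set MG := M *m _.
have entry i x : mxsub f g MG i x =
   if g x == l then a * M (f i) l + c * M (f i) r
   else if g x == r then b * M (f i) l + d * M (f i) r else M (f i) (g x).
  by rewrite mxE mul_local_mx.
have updE p : p = (ind g l, ind g r) ->
    F (upd l r (ind g) p) = v * \det (mxsub f g M).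
  by move=> ->; rewrite upd_id // FE.
have swapE p : p = (ind g r, ind g l) ->
    ~~ ((l \in codom g) && (r \in codom g)) ->
    F (upd l r (ind g) p) = v * \det (mxsub f (tperm l r \o g) M).
  by move=> -> nlr; rewrite -ind_tperm FE //; apply: strictly_increasing_tperm.
have indl : ind g l = (l \in codom g) by rewrite ffunE.
have indr : ind g r = (r \in codom g) by rewrite ffunE.
rewrite sum_bool_pair indl indr in updE swapE *.
case: (boolP (l \in codom g)) updE swapE => [lg|/negP lg];
  case: (boolP (r \in codom g)) => [rg|/negP rg] updE swapE /=;
  rewrite ?mulr0 ?addr0 ?add0r.
- have /codomP[p gp] := lg; have /codomP[q gq] := rg.
  have neq_pq : p != q by apply: contra_neq neq_rl => pq; rewrite gp gq pq.
  rewrite updE //.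
  rewrite (@det_two_cols _ _ (mxsub f g MG) (mxsub f g M) p q a b c d) //.
  + by ring.
  + by move=> i; rewrite entry -gp eqxx !mxE -gp -gq.
  + by move=> i; rewrite entry -gq (negbTE neq_rl) eqxx !mxE -gp -gq.
  + move=> i x xp xq; rewrite entry gp gq !(inj_eq inj_g).
    by rewrite (negbTE xp) (negbTE xq) mxE.
- have /codomP[p gp] := lg.
  have gpx x : x != p -> (g x == l) = false.
    by rewrite gp (inj_eq inj_g) => /negbTE.
  rewrite updE // swapE //.
  rewrite (@det_col_linear _ _ (mxsub f g MG) (mxsub f g M)
             (mxsub f (tperm l r \o g) M) p a c).
  + by ring.
  + by move=> i; rewrite entry -gp eqxx !mxE /= -gp tpermL.
  + move=> i x xp; rewrite entry gpx // mxE.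
    by case: eqP => // gx; case: rg; rewrite -gx codom_f.
  + move=> i x xp; rewrite entry gpx // mxE /=.
    rewrite tpermD; first by case: eqP => // gx; case: rg; rewrite -gx codom_f.
      by rewrite gp (inj_eq inj_g) eq_sym.
    by apply/eqP=> gx; case: rg; rewrite gx codom_f.
- have /codomP[p gp] := rg.
  have gpx x : x != p -> (g x == r) = false.
    by rewrite gp (inj_eq inj_g) => /negbTE.
  rewrite (updE (false, true)) // (swapE (true, false)) //.
  rewrite (@det_col_linear _ _ (mxsub f g MG) (mxsub f (tperm l r \o g) M)
             (mxsub f g M) p b d).
  + by ring.
  + by move=> i; rewrite entry -gp (negbTE neq_rl) eqxx !mxE /= -gp tpermR.
  + move=> i x xp; rewrite entry gpx // mxE /=.
    rewrite tpermD; first by case: eqP => // gx; case: lg; rewrite -gx codom_f.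
      by apply/eqP=> gx; case: lg; rewrite gx codom_f.
    by rewrite gp (inj_eq inj_g) eq_sym.
  + move=> i x xp; rewrite entry gpx // mxE.
    by case: eqP => // gx; case: lg; rewrite -gx codom_f.
- rewrite updE // mulrAC; congr (_ * \det _); apply/matrixP=> i x.
  rewrite entry mxE; case: eqP => [gx|_].
    by case: lg; rewrite -gx codom_f.
  by case: eqP => // gx; case: rg; rewrite -gx codom_f.
Qed.

(** * Braids *)

(** The Burau matrix of a generator: its action on W_(N,1), divided by its
    eigenvalue on e_0 (x) ... (x) e_0. *)
Definition burau_letter N (c : 'I_N.-1 * bool) : 'M[laurent]_N :=
  let: (i, s) := c in
  if s then local_mx (lpos i) (rpos i) (1 - sqrt_t ^+ 2) sqrt_t sqrt_t 0
  else local_mx (lpos i) (rpos i) 0 sqrt_tV sqrt_tV (1 - sqrt_tV ^+ 2).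

Definition burau N (b : braid N) : 'M[laurent]_N :=
  foldr (fun c M => M *m burau_letter c) 1%:M b.

(** The eigenvalue of V(b) on e_0 (x) ... (x) e_0. *)
Definition vacuum N (b : braid N) : laurent :=
  \prod_(c <- b) (if c.2 then sqrt_tV else sqrt_t).

Lemma Rmat_matchgate x y :
  Rmat x y = matchgate sqrt_tV (1 - sqrt_t ^+ 2) sqrt_t sqrt_t 0 x y.
Proof.
have stV : sqrt_tV * sqrt_t = 1 by rewrite mulrC sqrt_tK.
case: x => [[] []]; case: y => [[] []] //=; rewrite ?mulr0 //.
- by rewrite sub0r -expr2 mulrN expr2 mulrA stV mul1r.
- by rewrite mulrBr mulr1 expr2 mulrA stV mul1r.
Qed.

Lemma RmatV_matchgate x y :
  RmatV x y = matchgate sqrt_t 0 sqrt_tV sqrt_tV (1 - sqrt_tV ^+ 2) x y.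
Proof.
case: x => [[] []]; case: y => [[] []] //=; rewrite ?mulr0 ?sqrt_tK //.
- by rewrite mul0r sub0r -expr2 mulrN expr2 mulrA sqrt_tK mul1r.
- by rewrite mulrBr mulr1 expr2 mulrA sqrt_tK mul1r.
Qed.

(** If some value of [f] is not a value of [g], then it gives a zero row;
    otherwise the values agree by cardinality, hence so do the multi-indices. *)
Lemma minors_1 k N (f g : 'I_k -> 'I_N) :
  strictly_increasing f -> strictly_increasing g ->
  \det (mxsub f g 1%:M) = (ind f == ind g)%:R :> laurent.
Proof.
move=> incf incg; case: eqP => [eq_fg|neq_fg].
  rewrite -[RHS](det1 _ k); congr determinant; apply/matrixP=> i j.
  rewrite !mxE (ind_inj incf incg eq_fg).
  by rewrite (inj_eq (strictly_increasing_inj incg)).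
have [sub_fg|] := boolP [forall i, f i \in codom g]; last first.
  rewrite negb_forall => /existsP[i fi].
  rewrite (expand_det_row _ i) big1 // => j _; rewrite !mxE.
  by case: eqP fi => [->|_ _]; rewrite ?codom_f ?mul0r.
case: neq_fg; apply/ffunP=> x; rewrite !ffunE.
have sub : codom f \subset codom g.
  by apply/subsetP=> y /codomP[i ->]; apply: (forallP sub_fg).
apply: (subset_cardP _ sub); rewrite !card_codom //.
  exact: strictly_increasing_inj.
exact: strictly_increasing_inj.
Qed.

(** V(b) is [vacuum b] times the exterior algebra of the Burau matrix: the
    letters are added one at a time by [matchgate_minors]. *)
Lemma V_braid_minors N (b : braid N) k (f g : 'I_k -> 'I_N) :
  strictly_increasing f -> strictly_increasing g ->
  coef (V_braid b) (ind f) (ind g) = vacuum b * \det (mxsub f g (burau b)).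
Proof.
move=> incf; elim: b g => [|[i s] b IH] g incg /=.
  rewrite /vacuum big_nil mul1r minors_1 // /coef mxE.
  by rewrite (inj_eq enum_rank_inj).
rewrite coef_mulmx; under eq_bigr => z _ do rewrite coef_mkend.
rewrite sum_local; last by rewrite -val_eqE /=; lia.
rewrite /vacuum big_cons [_ * \prod_(_ <- _) _]mulrC /=.
have rl : rpos i = (lpos i).+1 :> nat by [].
case: s.
  under eq_bigr => p _ do rewrite Rmat_matchgate.
  exact: matchgate_minors IH _ incg.
under eq_bigr => p _ do rewrite RmatV_matchgate.
exact: matchgate_minors IH _ incg.
Qed.

(** * Closures *)

Lemma htensE m (x y : tbasis m) :
  htens x y = (x == y)%:R * (sqrt_t ^+ m * (-1) ^+ #|onset x|).
Proof.
case: eqP => [<-|neq_xy]; last first.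
  rewrite mul0r; have [eq_xy|] := boolP [forall i, x i == y i].
    by case: neq_xy; apply/ffunP=> i; apply/eqP; apply: (forallP eq_xy).
  rewrite negb_forall => /existsP[i xy].
  by rewrite /htens (bigD1 i) //= /hmat (negbTE xy) mul0r.
rewrite mul1r -[m in _ ^+ m]card_ord -[in RHS]prodr_const -prodr_const.
rewrite (big_mkcond (fun i => i \in onset x)) -big_split; apply: eq_bigr => i _.
by rewrite /hmat eqxx inE; case: (x i); rewrite /= ?mulrN1 ?mulr1.
Qed.

Lemma strictly_increasing_sum_map p q n m (f : 'I_p -> 'I_n)
    (g : 'I_q -> 'I_m) :
  strictly_increasing f -> strictly_increasing g ->
  strictly_increasing (sum_map f g).
Proof.
move=> incf incg i j; rewrite /sum_map.
case: (split_ordP i) => a ->; case: (split_ordP j) => b ->;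
  rewrite ?(sum_case_l, sum_case_r) /=.
- exact: incf.
- by have := ltn_ord (f a); lia.
- by have := ltn_ord b; lia.
- by rewrite !ltn_add2l; apply: incg.
Qed.

Lemma strictly_increasing_onset_val m (z : tbasis m) :
  strictly_increasing (onset_val z).
Proof.
move=> i j ij; rewrite /onset_val.
have x0 : 'I_m by apply: (enum_val i).
rewrite !(enum_val_nth x0).
have srt : sorted (fun a b : 'I_m => a < b)%N (enum (onset z)).
  apply: sorted_filter => [a b c|]; first exact: ltn_trans.
  by have := iota_ltn_sorted 0 m; rewrite -val_enum_ord enumT sorted_map.
apply: (sorted_ltn_nth _ x0 srt) => //; first by move=> a b c; apply: ltn_trans.
  by rewrite inE -cardE.
by rewrite inE -cardE.
Qed.

Lemma tjoin_ind p n m (f : 'I_p -> 'I_n) (z : tbasis m) :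
  tjoin (ind f) z = ind (sum_map f (onset_val z)).
Proof.
apply/ffunP=> x; transitivity (sum_case (ind f) z x); first by rewrite ffunE.
rewrite [RHS]ffunE /sum_map.
case: (split_ordP x) => y ->; rewrite ?(sum_case_l, sum_case_r) ?ffunE.
  apply/codomP/codomP => -[a].
    by move=> ->; exists (lshift _ a); rewrite sum_case_l.
  case: (split_ordP a) => b ->; rewrite ?(sum_case_l, sum_case_r) /=.
    by move/lshift_inj=> ->; exists b.
  by move/eqP; rewrite eq_lrshift.
apply/idP/codomP => [zy|[a]].
  have yz : y \in onset z by rewrite inE.
  exists (rshift p (enum_rank_in yz y)); rewrite sum_case_r /=.
  by rewrite /onset_val enum_rankK_in.
case: (split_ordP a) => b ->; rewrite ?(sum_case_l, sum_case_r) /=.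
  by move/eqP; rewrite eq_rlshift.
by move/rshift_inj=> ->; have := enum_valP b; rewrite inE.
Qed.

(** The weights of the trace are the signs of [det_principal_expansion]: a set
    of closed strands carrying e_1 contributes the minor of the Burau matrix
    that contains their rows and columns, with the sign of the parity of the
    set.  Closed strands come last, so adding them keeps the indices sorted. *)
Lemma partial_trace_minors n m (b : braid (n + m)) p (f g : 'I_p -> 'I_n) :
  strictly_increasing f -> strictly_increasing g ->
  coef (partial_trace (V_braid b)) (ind f) (ind g)
  = sqrt_t ^+ m * vacuum b *
    bordered (ulsubmx (burau b)) (ursubmx (burau b)) (- dlsubmx (burau b))
      (1%:M - drsubmx (burau b)) f g.
Proof.
move=> incf incg; rewrite coef_mkend /bordered.
have -> : colsub g (- dlsubmx (burau b)) = - colsub g (dlsubmx (burau b)).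
  by apply/matrixP=> i j; rewrite !mxE.
rewrite det_principal_expansion big_distrr /=; apply: eq_bigr => z _.
rewrite (bigD1 z) //= big1 ?addr0; last first.
  by move=> u /negbTE zu; rewrite htensE eq_sym zu !mul0r.
have inc_onset := strictly_increasing_onset_val (z := z).
rewrite htensE eqxx mul1r !tjoin_ind V_braid_minors; last first.
- exact: strictly_increasing_sum_map.
- exact: strictly_increasing_sum_map.
rewrite -!mulrA; congr (_ * _); rewrite mulrCA; do 2!congr (_ * _).
rewrite -[burau b in LHS]submxK !mxsub_sum_map.
by congr (\det (block_mx _ _ _ _)); apply/matrixP=> i j; rewrite !mxE.
Qed.

(** * The divisibility *)

Lemma W0_ind n (g : tend n) (f : 'I_0 -> 'I_n) : W0 g = coef g (ind f) (ind f).
Proof.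
have -> // : ind f = [ffun => false].
by apply/ffunP=> x; rewrite !ffunE; apply/codomP=> -[[]].
Qed.

Lemma W1_ind n (g : tend n) (i j : 'I_n) :
  W1 g i j = coef g (ind (fun _ : 'I_1 => i)) (ind (fun _ : 'I_1 => j)).
Proof.
have indE (x : 'I_n) : [ffun l => l == x] = ind (fun _ : 'I_1 => x).
  apply/ffunP=> l; rewrite !ffunE; apply/eqP/codomP => [->|[_ ->] //].
  by exists ord0.
by rewrite mxE !indE.
Qed.

(** Sylvester's identity, with the coefficients of the closure as bordered
    minors; the quotient by the power of [W0] is the coefficient of the closure
    at the same rows and columns. *)
Lemma minor_W1 n m (b : braid (n + m)) k (rows cols : 'I_k -> 'I_n) :
  (0 < k)%N -> strictly_increasing rows -> strictly_increasing cols ->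
  let g := partial_trace (V_braid b) in
  \det (mxsub rows cols (W1 g))
  = coef g (ind rows) (ind cols) * W0 g ^+ (k - 1).
Proof.
move=> k_gt0 incr incc g.
have inc1 (i : 'I_n) : strictly_increasing (fun _ : 'I_1 => i).
  by move=> x y; rewrite !ord1.
pose f0 (x : 'I_0) : 'I_n := widen_ord (leq0n n) x.
have inc0 : strictly_increasing f0 by case.
rewrite (W0_ind g f0) !partial_trace_minors // bordered_0.
set c := _ * vacuum b.
pose A := mxsub rows cols (ulsubmx (burau b)).
pose B := rowsub rows (ursubmx (burau b)).
pose C := colsub cols (- dlsubmx (burau b)).
have -> : mxsub rows cols (W1 g) = c *: \matrix_(i, j)
    bordered A B C (1%:M - drsubmx (burau b)) (fun _ : 'I_1 => i) (fun=> j).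
  apply/matrixP=> i j; rewrite mxE W1_ind partial_trace_minors // !mxE.
  congr (_ * _); congr (\det (block_mx _ _ _ _));
    by apply/matrixP=> x y; rewrite !mxE.
rewrite detZ sylvester // subn1 [in RHS]exprMn [RHS]mulrACA -exprS.
by rewrite (prednK k_gt0).
Qed.

Theorem corollary2 (n : nat) (hn : (1 <= n)%N)
  (T : tangle (ups n) (ups n)) (hT : string_link T)
  (VT : tend n) (hVT : is_V T VT)
  (k : nat) (hk : (1 <= k <= n)%N)
  (rows cols : 'I_k -> 'I_n)
  (hrows : strictly_increasing rows) (hcols : strictly_increasing cols) :
  exists q : laurent,
    \det (mxsub rows cols (W1 VT)) = q * W0 VT ^+ (k - 1).
Proof.
case: hVT => m [b [_ ->]]; eexists; apply: minor_W1 => //.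
by case/andP: hk.
Qed.
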